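(* Let $\mathcal{P}$ be a finite poset and let $\mathfrak{g}^{\prec}(\mathcal{P})$ be the associated nilpotent Lie poset algebra over $\mathbf{k}$. Then $$\operatorname{ind}\mathfrak{g}^{\prec}(\mathcal{P})=|Rel(\mathcal{P})|-2\sum_{p\in\mathcal{P}\setminus Ext(\mathcal{P})}\min\bigl(D(\mathcal{P},p),U(\mathcal{P},p)\bigr).$$
   Context: Let $\mathbf{k}$ be an algebraically closed field of characteristic zero (which may be taken to be $\mathbb{C}$). A finite poset $(\mathcal{P},\preceq)$ consists of a finite set $\mathcal{P}=\{1,\dots,n\}$ with a reflexive, antisymmetric, transitive relation $\preceq$; it is assumed that $x\preceq y$ implies $x\le y$ in $\mathbb{Z}$. Write $p\prec q$ if $p\preceq q$ and $p\ne q$ (a strict relation). $Rel(\mathcal{P})$ is the set of strict relations of $\mathcal{P}$, i.e. of pairs $(p,q)\in\mathcal{P}\times\mathcal{P}$ with $p\prec q$. $Ext(\mathcal{P})$ is the set of all elements of $\mathcal{P}$ that are minimal or maximal. For $p\in\mathcal{P}$, $D(\mathcal{P},p)=|\{q\in\mathcal{P}: q\prec p\}|$ and $U(\mathcal{P},p)=|\{q\in\mathcal{P}: p\prec q\}|$. The nilpotent Lie poset algebra $\mathfrak{g}^{\prec}(\mathcal{P})$ is the Lie algebra over $\mathbf{k}$ with basis $\{E_{p,q}: p,q\in\mathcal{P},\ p\prec q\}$ and bracket $[X,Y]=XY-YX$, where $E_{p,q}E_{r,s}=E_{p,s}$ if $q=r$ and $0$ otherwise; equivalently, it is the Lie algebra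 of $n\times n$ matrices over $\mathbf{k}$ whose $(i,j)$-entry can be nonzero only if $i\prec j$, under the commutator bracket. The index of a finite-dimensional Lie algebra $\mathfrak{g}$ is $\operatorname{ind}\mathfrak{g}=\min_{F\in\mathfrak{g}^*}\dim\ker(B_F)$, where $B_F$ is the skew-symmetric bilinear form $B_F(x,y)=F([x,y])$ on $\mathfrak{g}$ and $\ker(B_F)=\{x\in\mathfrak{g}: B_F(x,y)=0\text{ for all }y\in\mathfrak{g}\}$. *)

(* Defs.v *)
From HB Require Import structures.
From mathcomp Require Import all_boot all_order all_algebra.
From mathcomp Require Import boolp ring.

Set Implicit Arguments.
Unset Strict Implicit.
Unset Printing Implicit Defensive.

Import GRing.Theory.

Local Open Scope ring_scope.

HB.mixin Record Vector_isLie (k : fieldType) L of Vector k L := {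
  lie_bracket : L -> L -> L;
  lie_bracket_linearl : forall y, linear (lie_bracket ^~ y);
  lie_bracket_linearr : forall x, linear (lie_bracket x);
  lie_bracketxx : forall x, lie_bracket x x = 0;
  lie_jacobi : forall x y z,
    lie_bracket x (lie_bracket y z) + lie_bracket y (lie_bracket z x)
      + lie_bracket z (lie_bracket x y) = 0
}.

#[short(type="lieAlgType")]
HB.structure Definition LieAlgebra (k : fieldType) :=
  {L of Vector k L & Vector_isLie k L}.

Section Index.
Variables (k : fieldType) (L : lieAlgType k).
Implicit Types (F : 'Hom(L, k^o)) (x y : L).

(* The form B_F, as the linear map L -> L^* sending x to B_F(x, _). *)
Definition lie_form F : 'Hom(L, 'Hom(L, k^o)) :=
  linfun (fun x => linfun (fun y => F (lie_bracket x y))).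

Lemma lie_formE F x y : lie_form F x y = F (lie_bracket x y).
Proof.
pose linr x := GRing.isLinear.Build k L k^o *:%R
  (fun y => F (lie_bracket x y))
  (fun a u v => etrans (congr1 F (lie_bracket_linearr x a u v))
                       (linearP F a _ _)).
have inner z w :
    linfun (fun y => F (lie_bracket z y)) w = F (lie_bracket z w).
  pose g : {linear L -> k^o} := HB.pack (fun y => F (lie_bracket z y)) (linr z).
  exact: (lfunE g).
have outerL : linear (fun x => linfun (fun y => F (lie_bracket x y))).
  move=> a u v; apply/lfunP=> w.
  by rewrite add_lfunE scale_lfunE !inner lie_bracket_linearl linearP.
pose h : {linear L -> 'Hom(L, k^o)} :=
  HB.pack (fun x => linfun (fun y => F (lie_bracket x y)))
    (GRing.isLinear.Build k L 'Hom(L, k^o) *:%R _ outerL).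
by rewrite /lie_form (lfunE h) /= inner.
Qed.

Definition lie_kernel F : {vspace L} := lker (lie_form F).

Lemma lie_kernelP F x :
  reflect (forall y, F (lie_bracket x y) = 0) (x \in lie_kernel F).
Proof.
rewrite memv_ker; apply: (iffP eqP) => [x0 y | x0].
  by rewrite -lie_formE x0 zero_lfunE.
by apply/lfunP=> y; rewrite lie_formE x0 zero_lfunE.
Qed.

Lemma lie_kernel_dim_ex :
  exists d : nat, `[< exists F, \dim (lie_kernel F) = d >].
Proof. by exists (\dim (lie_kernel 0)); apply/asboolP; exists 0. Qed.

Definition lie_index : nat := ex_minn lie_kernel_dim_ex.

End Index.

(* Naturally labelled posets; 'I_n stands for {1, ..., n}. *)
Record poset (n : nat) := Poset {
  poset_le :> rel 'I_n;
  poset_refl : reflexive poset_le;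
  poset_anti : antisymmetric poset_le;
  poset_trans : transitive poset_le;
  poset_natural : forall x y, poset_le x y -> (x <= y)%N
}.

Section PosetData.
Variables (n : nat) (P : poset n).
Implicit Types p q : 'I_n.

Definition poset_lt : rel 'I_n := fun p q => P p q && (p != q).

Lemma poset_lt_trans : transitive poset_lt.
Proof.
move=> y x z /andP[xy nxy] /andP[yz nyz]; apply/andP; split.
  exact: poset_trans xy yz.
apply: contraNneq nxy => xz; apply/eqP; apply: (@poset_anti _ P).
by rewrite xy xz yz.
Qed.

Definition Rel : {set 'I_n * 'I_n} := [set pq | poset_lt pq.1 pq.2].

Definition poset_minimal p := [forall q, ~~ poset_lt q p].
Definition poset_maximal p := [forall q, ~~ poset_lt p q].
Definition Ext : {set 'I_n} := [set p | poset_minimal p || poset_maximal p].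

Definition D p : nat := #|[set q | poset_lt q p]|.
Definition U p : nat := #|[set q | poset_lt p q]|.

End PosetData.

Section NilLiePoset.
Variables (k : fieldType) (n : nat) (P : poset n).

Definition nil_lie_poset_space : {vspace 'M[k]_n} :=
  <<[seq delta_mx pq.1 pq.2 | pq <- enum (Rel P)]>>%VS.

Lemma nil_lie_poset_spaceP (A : 'M[k]_n) :
  reflect (forall i j, A i j != 0 -> poset_lt P i j)
          (A \in nil_lie_poset_space).
Proof.
apply: (iffP idP) => [/coord_span-> i j | A0].
  apply: contraNT => nij; rewrite summxE big1 // => l _; rewrite mxE.
  pose E : seq 'M[k]_n := [seq delta_mx pq.1 pq.2 | pq <- enum (Rel P)].
  have lE : (l < size E)%N by rewrite size_map -cardE.
  have /mapP[pq] := mem_nth 0 lE; rewrite -[nth 0 _ _]/(E`_l).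
  rewrite mem_enum inE => ltpq ->; rewrite mxE.
  case: eqP => [ei|_]; last by rewrite mulr0.
  case: eqP => [ej|_]; last by rewrite mulr0.
  by rewrite ei ej ltpq in nij.
rewrite [A]matrix_sum_delta; apply: rpred_sum => i _; apply: rpred_sum => j _.
have [->|/A0 ltij] := eqVneq (A i j) 0; first by rewrite scale0r mem0v.
apply/rpredZ/memv_span/mapP; exists (i, j) => //.
by rewrite mem_enum inE.
Qed.

Lemma nil_lie_poset_comm (A B : 'M[k]_n) :
  A \in nil_lie_poset_space -> B \in nil_lie_poset_space ->
  A *m B - B *m A \in nil_lie_poset_space.
Proof.
have mul (X Y : 'M[k]_n) : X \in nil_lie_poset_space ->
    Y \in nil_lie_poset_space -> X *m Y \in nil_lie_poset_space.
  move=> /nil_lie_poset_spaceP X0 /nil_lie_poset_spaceP Y0.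
  apply/nil_lie_poset_spaceP => i j; apply: contraNT => nij.
  rewrite mxE big1 // => l _.
  have [->|/X0 il] := eqVneq (X i l) 0; first by rewrite mul0r.
  have [->|/Y0 lj] := eqVneq (Y l j) 0; first by rewrite mulr0.
  by rewrite (poset_lt_trans il lj) in nij.
by move=> gA gB; rewrite rpredB ?mul.
Qed.

Definition nil_lie_poset : predArgType := subvs_of nil_lie_poset_space.

HB.instance Definition _ := Vector.on nil_lie_poset.

Definition nil_lie_poset_bracket (x y : nil_lie_poset) : nil_lie_poset :=
  Subvs (nil_lie_poset_comm (subvsP x) (subvsP y)).

Lemma nil_lie_poset_bracket_linearl y :
  linear (nil_lie_poset_bracket ^~ y).
Proof.
move=> a u v; apply: val_inj => /=.
by rewrite mulmxDl mulmxDr -scalemxAl -scalemxAr scalerBr opprD addrACA.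
Qed.

Lemma nil_lie_poset_bracket_linearr x : linear (nil_lie_poset_bracket x).
Proof.
move=> a u v; apply: val_inj => /=.
by rewrite mulmxDl mulmxDr -scalemxAl -scalemxAr scalerBr opprD addrACA.
Qed.

Lemma nil_lie_poset_bracketxx x : nil_lie_poset_bracket x x = 0.
Proof. by apply: val_inj; rewrite /= subrr. Qed.

Lemma nil_lie_poset_jacobi x y z :
  nil_lie_poset_bracket x (nil_lie_poset_bracket y z)
    + nil_lie_poset_bracket y (nil_lie_poset_bracket z x)
    + nil_lie_poset_bracket z (nil_lie_poset_bracket x y) = 0.
Proof.
apply: val_inj => /=; move: (vsval x) (vsval y) (vsval z) => {x y z} X Y Z.
rewrite !mulmxBl !mulmxBr !mulmxA; apply/matrixP => i j; rewrite !mxE.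
ring.
Qed.

HB.instance Definition _ := Vector_isLie.Build k nil_lie_poset
  nil_lie_poset_bracket_linearl nil_lie_poset_bracket_linearr
  nil_lie_poset_bracketxx nil_lie_poset_jacobi.

Lemma nil_lie_poset_bracketE (x y : nil_lie_poset) :
  vsval (lie_bracket x y) = vsval x *m vsval y - vsval y *m vsval x.
Proof. by []. Qed.

End NilLiePoset.

(* Main.v *)
From HB Require Import structures.
Require Import Defs.
From mathcomp Require Import all_boot all_order all_algebra.
From mathcomp Require Import boolp ring.

Set Implicit Arguments.
Unset Strict Implicit.
Unset Printing Implicit Defensive.

Import GRing.Theory.

Local Open Scope ring_scope.

(** The index is dim L - max rank B_F, and dim L = |Rel P|, so the point is that
the largest rank of B_F is 2N, where N = sum_q min(D q, U q); the extremal
elements contribute 0 to N.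

Upper bound ([lie_form_rank_le]).  Write f_ps for the value of F at E_ps.
Grouping the products E_pq E_qs = E_ps by their middle vertex q gives
B_F(x, y) = sum_q (phi_q(x, y) - phi_q(y, x)), where
phi_q(x, y) = sum_(p < q < s) x_pq f_ps y_qs is the bilinear form of a matrix
with D q rows and U q columns, hence has rank at most min(D q, U q).

Lower bound.  Call q low if D q <= U q, and high otherwise; the low elements
form a down-set.  Take F with f_ps = 1 / (s - p) when p is low and s is high,
and f_ps = 0 otherwise ([cauchy_form]).  Let V be the span of the E_pq with both
p and q low or both high.  Its dimension is N ([card_half_rel]): a low q
accounts for the D q relations below it, a high p for the U p relations above it.  A
product of two elements of V involves no E_ps with p low and s high, so V is
isotropic ([half_rel_isotropic]).  An isotropic subspace that meets the kernel
of a skew form trivially has dimension at most half the rank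
([isotropic_rank]), so it remains to see that V meets the kernel of B_F only
in 0 ([half_rel_transversal]).

Let x in V be in the kernel.  Pairing x with E_rs, for r low and s high, gives
sum_(p < r) x_pr f_ps = sum_(q > s) f_rq x_sq.  This links the block of r, of
size D r, consisting of the x_pr, to the block of s, of size U s, consisting of
the x_sq.  By induction on the size, all smaller blocks vanish.  The block of a
low r is then killed by the rows s > r with U s < D r of a Cauchy matrix, and
there are at least D r such s ([many_low_above]); so it vanishes
([cauchy_kernel0]).  The block of a high s is dual. *)

(** * Three general facts *)

(** In a basis Y of the image of b, let C be the matrix of coordinates of the
b(v_i), for a basis (v_i) of V, and R the matrix of the values of Y on the v_i.
Isotropy says that C R^T = 0.  Both C and R have rank dim V, because b is
injective on V and, by skewness, b x v = 0 for all x forces b v = 0. *)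
Lemma isotropic_rank (k : fieldType) (L : vectType k)
    (b : 'Hom(L, 'Hom(L, k^o))) (V : {vspace L}) :
  (forall x y, b x y = - b y x) -> {in V &, forall x y, b x y = 0} ->
  (V :&: lker b)%VS = 0%VS -> (2 * \dim V <= \dim (limg b))%N.
Proof.
move=> bskew bV0 Vb0; set N := \dim V; set r := \dim (limg b).
pose X := vbasis V; pose Y := vbasis (limg b).
have XV i : X`_i \in V.
  case: (ltnP i N) => ltiN; last by rewrite nth_default ?size_tuple ?mem0v.
  by apply/vbasis_mem/mem_nth; rewrite size_tuple.
pose C : 'M[k]_(N, r) := \matrix_(i, l) coord Y l (b X`_i).
pose R : 'M[k]_(N, r) := \matrix_(i, l) Y`_l X`_i.
have comb0 (w : 'I_N -> k) : b (\sum_i w i *: X`_i) = 0 -> forall i, w i = 0.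
  move=> bw0; apply: (freeP (basis_free (vbasisP V))).
  apply/eqP; rewrite -memv0 -Vb0 memv_cap memv_ker bw0 eqxx andbT.
  by apply: memv_suml => i _; apply: memvZ.
have bY x : b x = \sum_l coord Y l (b x) *: Y`_l.
  by apply: coord_vbasis; apply: memv_img; apply: memvf.
have CR0 : C *m R^T = 0.
  apply/matrixP=> i j; rewrite !mxE -[RHS](bV0 _ _ (XV i) (XV j)) bY sum_lfunE.
  by apply: eq_bigr => l _; rewrite !mxE scale_lfunE.
have freeC : row_free C.
  apply: inj_row_free => w wC0; apply/rowP=> i; rewrite mxE.
  apply: (comb0 (w 0)); rewrite bY big1 // => l _.
  have /rowP/(_ l) := wC0; rewrite !mxE => sum0.
  rewrite [coord _ _ _](_ : _ = 0) ?scale0r // -[RHS]sum0 !linear_sum.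
  by apply: eq_bigr => j _; rewrite !linearZ mxE.
have freeR : row_free R.
  apply: inj_row_free => w wR0; apply/rowP=> i; rewrite mxE.
  apply: (comb0 (w 0)); apply/lfunP=> x.
  rewrite bskew zero_lfunE bY sum_lfunE big1 ?oppr0 // => l _.
  have /rowP/(_ l) := wR0; rewrite !mxE => sum0.
  rewrite scale_lfunE [Y`_l _](_ : _ = 0) ?scaler0 // -[RHS]sum0 linear_sum.
  by apply: eq_bigr => j _; rewrite linearZ mxE.
have := mulmx0_rank_max CR0; rewrite mxrank_tr (eqP freeC) (eqP freeR).
by rewrite mul2n -addnn.
Qed.

(** A Cauchy matrix with at least as many rows as columns has trivial kernel.
Clearing denominators turns the sum of the c_i / (X - a_i) into a polynomial of
degree less than #|A| with the #|B| roots b_j, so it is zero; its value at a_i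
is c_i times a nonzero product. *)
Lemma cauchy_kernel0 (k : fieldType) (I J : finType) (a : I -> k) (b : J -> k)
    (A : {set I}) (B : {set J}) (c : I -> k) :
  injective a -> injective b -> {in B & A, forall j i, b j != a i} ->
  (#|A| <= #|B|)%N ->
  {in B, forall j, \sum_(i in A) c i / (b j - a i) = 0} ->
  {in A, forall i, c i = 0}.
Proof.
move=> inja injb ba leAB cB0.
(* The common denominator divided by its factor at i. *)
pose q i : {poly k} := \prod_(i' <- enum (A :\ i)) ('X - (a i')%:P).
have qE i x : (q i).[x] = \prod_(i' in A :\ i) (x - a i').
  by rewrite horner_prod big_enum /=; apply: eq_bigr => i' _; rewrite hornerXsubC.
pose p := \sum_(i in A) c i *: q i.
have pE x : p.[x] = \sum_(i in A) c i * (q i).[x].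
  by rewrite horner_sum; apply: eq_bigr => i _; rewrite hornerZ.
have szp : (size p <= #|A|)%N.
  apply: leq_trans (size_sum _ _ _) _; apply/bigmax_leqP => i iA.
  rewrite (leq_trans (size_scale_leq _ _)) // size_prod_XsubC -cardE.
  by rewrite (cardsD1 i A) iA.
have p0 : p = 0.
  apply/eqP; apply: contraTT leAB => nzp; rewrite -ltnNge.
  apply: leq_trans szp; rewrite cardE -(size_map b).
  apply: max_poly_roots => //; last by rewrite map_inj_uniq ?enum_uniq.
  apply/allP=> _ /mapP[j + ->]; rewrite mem_enum => jB; apply/rootP.
  transitivity ((\prod_(i in A) (b j - a i)) * \sum_(i in A) c i / (b j - a i)).
    rewrite pE mulr_sumr.
    apply: eq_bigr => i iA; rewrite qE (big_setD1 i iA) /=.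
    by rewrite mulrC [X in X * (_ / _)]mulrC mulrACA divff ?mulr1 ?subr_eq0 ?ba.
  by rewrite cB0 ?mulr0.
move=> i iA; apply/eqP; have := pE (a i); rewrite p0 horner0 (big_setD1 i iA) /=.
rewrite [X in _ + X]big1 => [|i']; last first.
  rewrite !inE => /andP[ni'i i'A]; rewrite qE (big_setD1 i) /= ?inE 1?eq_sym ?ni'i //.
  by rewrite subrr mul0r mulr0.
rewrite addr0 => /esym/eqP; rewrite mulf_eq0 => /orP[// | ].
rewrite qE => /prodf_eq0[i']; rewrite !inE => /andP[ni'i _].
by rewrite subr_eq0 (inj_eq inja) eq_sym (negPf ni'i).
Qed.

(** Among the elements y >= x with at least d elements above them, choose a
maximal one: everything above it has fewer than d elements above.  This is what
makes the induction on block sizes work, both for the order and its dual. *)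
Lemma many_low_above (T : finType) (lt : rel T) (x : T) (d : nat) :
  irreflexive lt -> transitive lt ->
  (d <= #|[set y | lt x y]|)%N ->
  (d <= #|[set y | lt x y & (#|[set z | lt y z]| < d)%N]|)%N.
Proof.
move=> ltxx lt_trans; pose up y := #|[set z | lt y z]|; rewrite -/(up x).
have [m] := ubnP (up x); elim: m x => // m IHm x ltxm ledx.
case: (pickP [pred y | lt x y & (d <= up y)%N]) => [y /andP[xy ledy] | none].
  have ltyx : (up y < up x)%N.
    apply/proper_card/properP; split.
      by apply/subsetP=> z; rewrite !inE; apply: lt_trans xy.
    by exists y; rewrite inE ?xy ?ltxx.
  apply: leq_trans (IHm y (leq_trans ltyx ltxm) ledy) _.
  apply/subset_leq_card/subsetP=> z; rewrite !inE => /andP[yz ->].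
  by rewrite (lt_trans _ _ _ xy yz).
apply: leq_trans ledx _; apply/subset_leq_card/subsetP=> y; rewrite !inE => xy.
by rewrite xy ltnNge; have := none y; rewrite /= xy /= => ->.
Qed.

(** * The basis of elementary matrices *)

Lemma entry_eq0 (k : fieldType) n (P : poset n) (x : nil_lie_poset k P) i j :
  ~~ poset_lt P i j -> vsval x i j = 0.
Proof.
move=> nij; apply/eqP; apply: contraNT nij.
exact: (nil_lie_poset_spaceP _ _ (subvsP x)).
Qed.

(** The projection makes this total in i and j; its value is the elementary
matrix E_ij only when i strictly precedes j. *)
Definition elem (k : fieldType) n (P : poset n) (i j : 'I_n) :
    nil_lie_poset k P :=
  vsproj (nil_lie_poset_space k P) (delta_mx i j).

Lemma elemE (k : fieldType) n (P : poset n) i j :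
  poset_lt P i j -> vsval (elem k P i j) = delta_mx i j.
Proof.
move=> ij; apply: vsprojK; apply/nil_lie_poset_spaceP => i' j'.
by rewrite mxE; case: (i' =P i) => [->|]; case: (j' =P j) => [->|]; rewrite ?eqxx.
Qed.

Lemma sum_elem (k : fieldType) n (P : poset n) (x : nil_lie_poset k P) :
  x = \sum_i \sum_j vsval x i j *: elem k P i j.
Proof.
rewrite -[LHS]vsvalK [in LHS](matrix_sum_delta (vsval x)) linear_sum.
apply: eq_bigr => i _; rewrite linear_sum; apply: eq_bigr => j _.
by rewrite linearZ.
Qed.

Definition entry (k : fieldType) n (P : poset n) (i j : 'I_n) :
    'Hom(nil_lie_poset k P, k^o) :=
  linfun (fun x : nil_lie_poset k P => vsval x i j : k^o).

Lemma entryE (k : fieldType) n (P : poset n) i j (x : nil_lie_poset k P) :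
  entry k P i j x = vsval x i j.
Proof.
have lin_ij : linear (fun x : nil_lie_poset k P => vsval x i j : k^o).
  by move=> a u v; rewrite linearP !mxE.
pose g : {linear nil_lie_poset k P -> k^o} :=
  HB.pack (fun x : nil_lie_poset k P => vsval x i j : k^o)
    (GRing.isLinear.Build k (nil_lie_poset k P) k^o *:%R _ lin_ij).
exact: (lfunE g).
Qed.

Definition elem_span (k : fieldType) n (P : poset n) (S : {set 'I_n * 'I_n}) :
    {vspace nil_lie_poset k P} :=
  <<[seq elem k P e.1 e.2 | e <- enum S]>>%VS.

Lemma elem_spanP (k : fieldType) n (P : poset n) (S : {set 'I_n * 'I_n})
    (x : nil_lie_poset k P) :
  S \subset Rel P ->
  reflect (forall i j, vsval x i j != 0 -> (i, j) \in S) (x \in elem_span k P S).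
Proof.
move=> /subsetP SRel; apply: (iffP idP) => [/coord_span-> i j | xS].
  apply: contraNT => nij; rewrite linear_sum summxE big1 // => l _.
  pose E := [seq elem k P e.1 e.2 | e <- enum S].
  have lE : (l < size E)%N by rewrite size_map -cardE.
  have /mapP[[p q]] := mem_nth 0 lE; rewrite -[nth 0 _ _]/(E`_l).
  rewrite mem_enum => pqS /= ->; rewrite elemE; last first.
    by have := SRel _ pqS; rewrite inE.
  rewrite !mxE; case: eqP => [ei|_]; last by rewrite mulr0.
  case: eqP => [ej|_]; last by rewrite mulr0.
  by rewrite ei ej pqS in nij.
rewrite [x]sum_elem; apply: rpred_sum => i _; apply: rpred_sum => j _.
have [->|/xS ijS] := eqVneq (vsval x i j) 0; first by rewrite scale0r mem0v.
by apply/rpredZ/memv_span/mapP; exists (i, j); rewrite ?mem_enum.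
Qed.

Lemma dim_elem_span (k : fieldType) n (P : poset n) (S : {set 'I_n * 'I_n}) :
  S \subset Rel P -> \dim (elem_span k P S) = #|S|.
Proof.
move=> /subsetP SRel.
pose E := map_tuple (fun e => elem k P e.1 e.2) (enum_tuple S).
suff /eqP : free E by rewrite size_tuple.
apply/freeP=> c c0 l.
have eE (l' : 'I_#|S|) : E`_l' = elem k P (enum_val l').1 (enum_val l').2.
  rewrite (nth_map (enum_default l')) ?size_tuple //.
have /(congr1 (fun x : nil_lie_poset k P =>
    vsval x (enum_val l).1 (enum_val l).2)) := c0.
rewrite linear_sum summxE mxE (bigD1 l) //= eE /= elemE; last first.
  by have := SRel _ (enum_valP l); rewrite inE.
rewrite !mxE !eqxx mulr1 big1 ?addr0 // => l' nl'l.
rewrite eE /= elemE; last by have := SRel _ (enum_valP l'); rewrite inE.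
rewrite !mxE -[_ && _]/((enum_val l == enum_val l')) (inj_eq enum_val_inj).
by rewrite eq_sym (negPf nl'l) mulr0.
Qed.

Lemma dim_nil_lie_poset (k : fieldType) n (P : poset n) :
  \dim {:nil_lie_poset k P} = #|Rel P|.
Proof.
rewrite -(dim_elem_span k (subxx (Rel P))); congr (\dim _).
apply/vspaceP=> x; rewrite memvf; apply/esym/(elem_spanP _ (subxx _)) => i j.
by rewrite inE; apply: contraNT => /entry_eq0->.
Qed.

Lemma functional_sum (k : fieldType) n (P : poset n)
    (F : 'Hom(nil_lie_poset k P, k^o)) (x : nil_lie_poset k P) :
  F x = \sum_p \sum_s vsval x p s * F (elem k P p s).
Proof.
rewrite {1}[x]sum_elem linear_sum; apply: eq_bigr => p _.
by rewrite linear_sum; apply: eq_bigr => s _; rewrite linearZ.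
Qed.

(** * The rank of B_F is at most 2N *)

(** The index q is the middle vertex of the products E_pq E_qs. *)
Lemma lie_form_sum (k : fieldType) n (P : poset n)
    (F : 'Hom(nil_lie_poset k P, k^o)) (x y : nil_lie_poset k P) :
  lie_form F x y =
    \sum_q (\sum_p \sum_s vsval x p q * F (elem k P p s) * vsval y q s
          - \sum_s \sum_p vsval x q s * F (elem k P p s) * vsval y p q).
Proof.
rewrite lie_formE functional_sum nil_lie_poset_bracketE.
under eq_bigr => p _.
  under eq_bigr => s _ do rewrite !mxE -sumrB mulr_suml.
  over.
under [RHS]eq_bigr => q _.
  rewrite [X in _ - X]exchange_big /= -sumrB.
  under eq_bigr do rewrite -sumrB.
  over.
rewrite [RHS]exchange_big; apply: eq_bigr => p _.
rewrite [RHS]exchange_big; apply: eq_bigr => s _.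
by apply: eq_bigr => q _; rewrite /=; ring.
Qed.

(** Each functional B_F(x, -) is a sum over q of a functional in W q.  The parts
phi_q(x, -) and phi_q(-, x) can each be expanded along the incoming relations
(p, q) or along the outgoing relations (q, s); W q follows the fewer. *)
Lemma lie_form_rank_le (k : fieldType) n (P : poset n)
    (F : 'Hom(nil_lie_poset k P, k^o)) :
  (\dim (limg (lie_form F)) <= 2 * \sum_q minn (D P q) (U P q))%N.
Proof.
pose ein q := [seq entry k P p q | p <- enum [set p | poset_lt P p q]].
pose eout q := [seq entry k P q s | s <- enum [set s | poset_lt P q s]].
pose f p s : k := F (elem k P p s).
pose gin q s : 'Hom(nil_lie_poset k P, k^o) := \sum_p f p s *: entry k P p q.
pose gout q p : 'Hom(nil_lie_poset k P, k^o) := \sum_s f p s *: entry k P q s.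
pose W q : {vspace 'Hom(nil_lie_poset k P, k^o)} :=
  if (D P q <= U P q)%N
  then (<<[seq gout q p | p <- enum [set p | poset_lt P p q]]>> + <<ein q>>)%VS
  else (<<eout q>> + <<[seq gin q s | s <- enum [set s | poset_lt P q s]]>>)%VS.
have entry0 p q : ~~ poset_lt P p q -> entry k P p q = 0.
  by move=> npq; apply/lfunP=> x; rewrite entryE zero_lfunE entry_eq0.
have ginP q s : gin q s \in <<ein q>>%VS.
  apply: memv_suml => p _; apply: memvZ.
  have [pq|/entry0->] := boolP (poset_lt P p q); last exact: mem0v.
  by apply/memv_span/map_f; rewrite mem_enum inE.
have goutP q p : gout q p \in <<eout q>>%VS.
  apply: memv_suml => s _; apply: memvZ.
  have [qs|/entry0->] := boolP (poset_lt P q s); last exact: mem0v.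
  by apply/memv_span/map_f; rewrite mem_enum inE.
have dimW q : (\dim (W q) <= 2 * minn (D P q) (U P q))%N.
  rewrite /W mul2n -addnn; case: (leqP (D P q)) => _;
  apply: leq_trans (dimv_add_leqif _ _).1 _; apply: leq_add;
  by apply: leq_trans (dim_span _) _; rewrite size_map -cardE.
have imW : (limg (lie_form F) <= \sum_q W q)%VS.
  apply/subvP=> _ /memv_imgP[x _ ->].
  have -> : lie_form F x = \sum_q (\sum_p vsval x p q *: gout q p
                                   - \sum_s vsval x q s *: gin q s).
    apply/lfunP=> y; rewrite lie_form_sum sum_lfunE; apply: eq_bigr => q _.
    rewrite add_lfunE opp_lfunE !sum_lfunE; congr (_ - _).
      apply: eq_bigr => p _; rewrite scale_lfunE sum_lfunE scaler_sumr.
      by apply: eq_bigr => s _; rewrite scale_lfunE entryE -mulrA.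
    apply: eq_bigr => s _; rewrite scale_lfunE sum_lfunE scaler_sumr.
    by apply: eq_bigr => p _; rewrite scale_lfunE entryE -mulrA.
  apply: memv_sumr => q _; rewrite /W; case: leqP => _; apply: memv_add.
  - apply: memv_suml => p _.
    have [pq|/entry_eq0->] := boolP (poset_lt P p q); last first.
      by rewrite scale0r mem0v.
    by apply/memvZ/memv_span/map_f; rewrite mem_enum inE.
  - by rewrite memvN; apply: memv_suml => s _; apply/memvZ/ginP.
  - by apply: memv_suml => p _; apply/memvZ/goutP.
  rewrite memvN; apply: memv_suml => s _.
  have [qs|/entry_eq0->] := boolP (poset_lt P q s); last first.
    by rewrite scale0r mem0v.
  by apply/memvZ/memv_span/map_f; rewrite mem_enum inE.
apply: leq_trans (dimvS imW) _; apply: leq_trans (dimv_leq_sum _ _ _) _.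
by rewrite big_distrr /=; apply: leq_sum.
Qed.

(** * Low and high elements *)

Lemma poset_lt_irr n (P : poset n) : irreflexive (poset_lt P).
Proof. by move=> p; rewrite /poset_lt eqxx andbF. Qed.

Lemma D_le n (P : poset n) p q : poset_lt P p q -> (D P p <= D P q)%N.
Proof.
move=> pq; apply/subset_leq_card/subsetP=> r; rewrite !inE => rp.
exact: poset_lt_trans rp pq.
Qed.

Lemma U_le n (P : poset n) p q : poset_lt P p q -> (U P q <= U P p)%N.
Proof.
by move=> pq; apply/subset_leq_card/subsetP=> r; rewrite !inE; apply: poset_lt_trans.
Qed.

Definition low n (P : poset n) : pred 'I_n := fun q => (D P q <= U P q)%N.

Lemma low_down n (P : poset n) p q : poset_lt P p q -> low P q -> low P p.
Proof.
by move=> pq lowq; rewrite /low (leq_trans (D_le pq)) ?(leq_trans lowq) ?U_le.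
Qed.

(** Since the low elements form a down-set, these are the relations between two
low elements or between two high elements. *)
Definition half_rel n (P : poset n) : {set 'I_n * 'I_n} :=
  [set e in Rel P | low P e.2 || ~~ low P e.1].

Lemma half_relS n (P : poset n) : half_rel P \subset Rel P.
Proof. by apply/subsetP=> e; rewrite inE => /andP[]. Qed.

(** Relations between low elements are counted at their upper end q, where the
minimum is D q; relations between high elements at their lower end, where it is
U q. *)
Lemma card_half_rel n (P : poset n) :
  #|half_rel P| = (\sum_q minn (D P q) (U P q))%N.
Proof.
transitivity (\sum_p \sum_q ((poset_lt P p q && low P q)
                             + (poset_lt P p q && ~~ low P p)))%N.
  rewrite -sum1_card big_mkcond pair_bigA; apply: eq_bigr => -[p q] _ /=.
  rewrite !inE /=; have [pq|//] := boolP (poset_lt P p q).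
  by case: (boolP (low P q)) => [/(low_down pq)->|_] //; case: (low P p).
under eq_bigr do rewrite big_split /=.
rewrite big_split /= exchange_big -big_split; apply: eq_bigr => q _ /=.
have DE : D P q = (\sum_p (poset_lt P p q : nat))%N.
  by rewrite /D -sum1_card big_mkcond; apply: eq_bigr => p _; rewrite inE.
have UE : U P q = (\sum_s (poset_lt P q s : nat))%N.
  by rewrite /U -sum1_card big_mkcond; apply: eq_bigr => s _; rewrite inE.
rewrite /low; case: (leqP (D P q) (U P q)) => _.
  rewrite [X in (_ + X)%N]big1 ?addn0 => [|s _]; last by rewrite andbF.
  by rewrite DE; apply: eq_bigr => p _; rewrite andbT.
rewrite big1 ?add0n => [|s _]; last by rewrite andbF.
by rewrite UE; apply: eq_bigr => p _; rewrite andbT.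
Qed.

(** * A functional of maximal rank *)

Definition cauchy_coef (k : fieldType) n (P : poset n) (p s : 'I_n) : k :=
  if low P p && ~~ low P s then (s%:R - p%:R)^-1 else 0.

Definition cauchy_form (k : fieldType) n (P : poset n) :
    'Hom(nil_lie_poset k P, k^o) :=
  \sum_p \sum_s cauchy_coef k P p s *: entry k P p s.

Lemma cauchy_formE (k : fieldType) n (P : poset n) (x : nil_lie_poset k P) :
  cauchy_form k P x = \sum_p \sum_s cauchy_coef k P p s * vsval x p s.
Proof.
rewrite sum_lfunE; apply: eq_bigr => p _; rewrite sum_lfunE.
by apply: eq_bigr => s _; rewrite scale_lfunE entryE.
Qed.

(** A nonzero product E_pq E_qs with p low and s high would need both q low,
from the first factor, and q high, from the second. *)
Lemma half_rel_isotropic (k : fieldType) n (P : poset n) :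
  {in elem_span k P (half_rel P) &,
    forall x y, lie_form (cauchy_form k P) x y = 0}.
Proof.
have prod0 (x y : nil_lie_poset k P) p q s :
    x \in elem_span k P (half_rel P) -> y \in elem_span k P (half_rel P) ->
    low P p && ~~ low P s -> vsval x p q * vsval y q s = 0.
  move=> /(elem_spanP _ (half_relS P)) xS /(elem_spanP _ (half_relS P)) yS.
  move=> /andP[lowp highs].
  have [->|/xS] := eqVneq (vsval x p q) 0; first by rewrite mul0r.
  have [->|/yS] := eqVneq (vsval y q s) 0; first by rewrite mulr0.
  by rewrite !inE /= lowp (negPf highs) orbF => /andP[_ /negPf->] /andP[].
move=> x y xS yS; rewrite lie_formE cauchy_formE big1 // => p _.
rewrite big1 // => s _; rewrite /cauchy_coef; case: ifP => [ps|]; last first.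
  by rewrite mul0r.
rewrite nil_lie_poset_bracketE !mxE.
by rewrite !big1 ?subrr ?mulr0 // => q _; apply: prod0.
Qed.

Lemma cauchy_form_elem (k : fieldType) n (P : poset n) (x : nil_lie_poset k P)
    r s : poset_lt P r s ->
  lie_form (cauchy_form k P) x (elem k P r s) =
    \sum_p cauchy_coef k P p s * vsval x p r
    - \sum_q cauchy_coef k P r q * vsval x s q.
Proof.
move=> rs; rewrite lie_formE cauchy_formE nil_lie_poset_bracketE elemE //.
have mulr_delta (A : 'M[k]_n) p t : (A *m delta_mx r s) p t = A p r *+ (t == s).
  rewrite mxE (bigD1 r) //= big1 => [|q /negPf nqr].
    by rewrite mxE eqxx /= addr0 mulr_natr.
  by rewrite mxE nqr mulr0.
have mull_delta (A : 'M[k]_n) p t : (delta_mx r s *m A) p t = A s t *+ (p == r).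
  rewrite mxE (bigD1 s) //= big1 => [|q /negPf nqs].
    by rewrite mxE eqxx andbT addr0 mulr_natl.
  by rewrite mxE nqs andbF mul0r.
pose E := delta_mx r s : 'M[k]_n.
have bracketE p t : (vsval x *m E - E *m vsval x) p t
    = vsval x p r *+ (t == s) - vsval x s t *+ (p == r).
  by rewrite -mulr_delta -mull_delta [LHS]mxE; congr (_ + _); rewrite mxE.
under eq_bigr do under eq_bigr do rewrite bracketE mulrBr.
under eq_bigr do rewrite sumrB.
rewrite sumrB; congr (_ - _).
  apply: eq_bigr => p _; rewrite (bigD1 s) //= eqxx big1 ?addr0 // => t.
  by move=> /negPf->; rewrite mulr0.
rewrite (bigD1 r) //= eqxx [X in _ + X]big1 ?addr0 // => p /negPf-> /=.
by rewrite big1 // => t _; rewrite mulr0.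
Qed.

(** Characteristic zero makes the integers labelling the vertices distinct in k,
as nodes of Cauchy matrices must be.  The proof is by induction on the common
bound d for the sizes of the blocks (x_pr)_p, r low, and (x_rq)_q, r high. *)
Lemma half_rel_transversal (k : fieldType) n (P : poset n) :
  [pchar k] =i pred0 ->
  (elem_span k P (half_rel P) :&: lker (lie_form (cauchy_form k P)))%VS = 0%VS.
Proof.
move=> char0; apply/eqP; rewrite -subv0; apply/subvP=> x.
rewrite memv_cap memv0 => /andP[/(elem_spanP _ (half_relS P)) xS xker].
have xE r s : poset_lt P r s -> \sum_p cauchy_coef k P p s * vsval x p r =
                           \sum_q cauchy_coef k P r q * vsval x s q.
  move=> rs; apply/eqP; rewrite -subr_eq0 -cauchy_form_elem //.
  by rewrite lie_formE (lie_kernelP _ _ xker).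
have nat_inj : injective (fun i : 'I_n => i%:R : k).
  have natr_eq0 := (pcharf0P k).1 char0.
  move=> i j eqij; apply/val_inj/eqP.
  wlog leij : i j eqij / (i <= j)%N => [wl|].
    by case/orP: (leq_total i j) => /wl; [|rewrite eq_sym]; apply.
  by rewrite eqn_leq leij -subn_eq0 -natr_eq0 natrB // -eqij subrr eqxx.
(* For high blocks the coefficients 1 / (q - r) have the unknowns indexed by q,
   so the Cauchy nodes are the opposites -q and -r. *)
have neg_inj : injective (fun i : 'I_n => - i%:R : k).
  by move=> i j /oppr_inj /nat_inj.
have many_above q d : (d <= U P q)%N ->
    (d <= #|[set s | poset_lt P q s & (U P s < d)%N]|)%N.
  exact: (many_low_above (@poset_lt_irr _ P) (@poset_lt_trans _ P)).
have many_below q d : (d <= D P q)%N ->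
    (d <= #|[set p | poset_lt P p q & (D P p < d)%N]|)%N.
  apply: (@many_low_above _ (fun p q => poset_lt P q p)).
    exact: poset_lt_irr.
  by move=> ? ? ? qp rq; apply: poset_lt_trans rq qp.
have block0 d r :
    (low P r -> (D P r < d)%N -> forall p, vsval x p r = 0) /\
    (~~ low P r -> (U P r < d)%N -> forall q, vsval x r q = 0).
  elim: d r => [//|d IHd] r; split => [lowr ltrd p | highr ltrd q].
    have [pr|/entry_eq0//] := boolP (poset_lt P p r).
    apply: (cauchy_kernel0 (A := [set p | poset_lt P p r])
             (c := fun p => vsval x p r) nat_inj nat_inj _
             (many_above r (D P r) lowr)) => [s p'|s|]; rewrite !inE //.
      move=> /andP[rs _] p'r; rewrite (inj_eq nat_inj).
      by have /andP[_] := poset_lt_trans p'r rs; rewrite eq_sym.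
    move=> /andP[rs ltsr].
    have highs : ~~ low P s by rewrite -ltnNge (leq_trans ltsr) ?D_le.
    transitivity (\sum_q cauchy_coef k P r q * vsval x s q); last first.
      rewrite big1 // => q _; rewrite (IHd s).2 ?mulr0 //.
      exact: leq_trans ltsr _.
    rewrite -xE // big_mkcond; apply: eq_bigr => p' _; rewrite inE.
    case: ifPn => [p'r|/entry_eq0->]; last by rewrite mulr0.
    by rewrite /cauchy_coef (low_down p'r) // highs mulrC.
  have [rq|/entry_eq0//] := boolP (poset_lt P r q).
  have leUD : (U P r <= D P r)%N by rewrite ltnW // ltnNge.
  apply: (cauchy_kernel0 (A := [set q | poset_lt P r q])
           (c := fun q => vsval x r q) neg_inj neg_inj _
           (many_below r (U P r) leUD)) => [s q'|s|]; rewrite !inE //.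
    move=> /andP[sr _] rq'; rewrite (inj_eq neg_inj).
    by have /andP[_] := poset_lt_trans sr rq'.
  move=> /andP[sr ltsr].
  have lows : low P s by rewrite /low (leq_trans (ltnW ltsr)) ?U_le.
  transitivity (\sum_p cauchy_coef k P p r * vsval x p s); last first.
    rewrite big1 // => p _; rewrite (IHd s).1 ?mulr0 //.
    exact: leq_trans ltsr _.
  rewrite xE // big_mkcond; apply: eq_bigr => q' _; rewrite inE.
  case: ifPn => [rq'|/entry_eq0->]; last by rewrite mulr0.
  have highq' : ~~ low P q' by apply: contra highr => /(low_down rq').
  by rewrite /cauchy_coef lows highq' mulrC opprK addrC.
apply/eqP/val_inj/matrixP=> i j; rewrite mxE; apply/eqP.
apply: contraT => xij; have := xS _ _ xij; rewrite inE /= => /andP[_ /orP[]].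
  by move=> lowj; rewrite (block0 (D P j).+1 j).1 ?eqxx // in xij.
by move=> highi; rewrite (block0 (U P i).+1 i).2 ?eqxx // in xij.
Qed.

(** * The index *)

Theorem theorem4 (k : closedFieldType) (char0 : [pchar k] =i pred0)
    (n : nat) (P : poset n) :
  (lie_index (nil_lie_poset k P))%:Z =
    #|Rel P|%:Z - 2 * \sum_(p | p \notin Ext P) (minn (D P p) (U P p))%:Z.
Proof.
set L := nil_lie_poset k P; set N := (\sum_q minn (D P q) (U P q))%N.
have dimker (F : 'Hom(L, k^o)) :
    (\dim (lie_kernel F) + \dim (limg (lie_form F)) = #|Rel P|)%N.
  have := limg_ker_dim (lie_form F) fullv; rewrite capfv => dimE.
  exact: etrans dimE (dim_nil_lie_poset k P).
have rank_ge : (2 * N <= \dim (limg (lie_form (cauchy_form k P))))%N.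
  rewrite /N -card_half_rel -(dim_elem_span k (half_relS P)).
  apply: isotropic_rank.
  - move=> x y; rewrite !lie_formE -linearN; congr (cauchy_form _ _ _).
    by apply: val_inj; rewrite /= opprB.
  - exact: half_rel_isotropic.
  exact: half_rel_transversal.
have indexE : (lie_index L + 2 * N = #|Rel P|)%N.
  rewrite /lie_index; case: ex_minnP => d /asboolP[F <-] dmin.
  apply/eqP; rewrite eqn_leq -{2}(dimker F) leq_add2l lie_form_rank_le andbT.
  rewrite -(dimker (cauchy_form k P)) leq_add //.
  by apply: dmin; apply/asboolP; exists (cauchy_form k P).
have sumE : \sum_(p | p \notin Ext P) (minn (D P p) (U P p))%:Z = N%:Z.
  rewrite /N (big_morph Posz PoszD (erefl _)).
  rewrite big_mkcond /= ; apply: eq_bigr => p _; case: ifPn => //.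
  rewrite negbK inE => /orP[]/forallP none; rewrite /D /U.
    by rewrite (_ : [set q | poset_lt P q p] = set0) ?cards0 ?min0n //;
    apply/setP=> q; rewrite !inE (negPf (none q)).
  rewrite (_ : [set q | poset_lt P p q] = set0) ?cards0 ?minn0 //.
  by apply/setP=> q; rewrite !inE (negPf (none q)).
by rewrite sumE -indexE PoszD PoszM addrK.
Qed.
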